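(* Let $E$ be a binary exposure, $D$ a binary outcome and $U$ an unmeasured confounder with levels $0,1,\dots,K-1$. With $\mathrm{RR}^{\mathrm{obs}}_{ED}$, $\mathrm{RR}^{\mathrm{true}}_{ED}$, $\mathrm{RR}_{EU}$ and $\mathrm{RR}_{UD}$ as defined in the context, $$\mathrm{RR}^{\mathrm{true}}_{ED}\ \ge\ \mathrm{RR}^{\mathrm{obs}}_{ED}\Big/ \frac{\mathrm{RR}_{EU}\times \mathrm{RR}_{UD}}{\mathrm{RR}_{EU}+\mathrm{RR}_{UD}-1}.$$
   Context: All probabilities are conditional on a fixed stratum $C=c$ of the measured confounders; this conditioning is suppressed in the notation. $E,D\in\{0,1\}$ and $U\in\{0,\dots,K-1\}$ are random variables on a common probability space ($U$ may encode several confounders). All conditional probabilities below are assumed well defined, i.e. $P(E=e,U=k)>0$ for all $e,k$, and all denominators below are assumed nonzero. No other assumption on the joint distribution of $(E,D,U)$ is made. Observed relative risk: $\mathrm{RR}^{\mathrm{obs}}_{ED}=P(D=1\mid E=1)/P(D=1\mid E=0)$. Standardized (true) relative risk: $$\mathrm{RR}^{\mathrm{true}}_{ED}=\frac{\sum_{k=0}^{K-1}P(D=1\mid E=1,U=k)P(U=k)}{\sum_{k=0}^{K-1}P(D=1\mid E=0,U=k)P(U=k)}.$$ Exposure-confounder maximal relative risk: $\mathrm{RR}_{EU}=\max_k \dfrac{P(U=k\mid E=1)}{P(U=k\mid E=0)}$. Confounder-outcome maximal relative risk: $\mathrm{RR}_{UD}=\max(\mathrm{RR}_{UD|E=1},\mathrm{RR}_{UD|E=0})$,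 where for $e\in\{0,1\}$, $\mathrm{RR}_{UD|E=e}=\dfrac{\max_k P(D=1\mid E=e,U=k)}{\min_k P(D=1\mid E=e,U=k)}$. *)

(* Defs.v *)
From HB Require Import structures.
From mathcomp Require Import all_boot all_order all_algebra.
From mathcomp Require Import all_classical all_reals all_analysis.

Set Implicit Arguments.
Unset Strict Implicit.
Unset Printing Implicit Defensive.
Import Order.TTheory GRing.Theory Num.Theory.

Local Open Scope classical_set_scope.
Local Open Scope ring_scope.

Section relative_risks.
Context {d : measure_display} {T : measurableType d} {R : realType}.
Variable P : probability T R.

(* fine loses no information since P is finite *)
Definition prob (A : set T) : R := fine (P A).

(* P(A | B); division by 0 makes it 0 when P(B) = 0 *)
Definition cprob (A B : set T) : R := prob (A `&` B) / prob B.

(* Maximum and minimum over the levels 0, ..., K - 1. For K > 0 the initial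
   value f 0 is one of the values compared, so it does not alter the result;
   K = 0 cannot occur for a random variable with values in {0, ..., K - 1}. *)
Definition max_level (K : nat) (f : nat -> R) : R :=
  \big[Num.max/f 0%N]_(k < K) f k.

Definition min_level (K : nat) (f : nat -> R) : R :=
  \big[Num.min/f 0%N]_(k < K) f k.

(* Binary variables are boolean: the value 1 is true and the value 0 is false.
   The confounder U is nat-valued, and K is its number of levels. *)
Variables (E D : {RV P >-> bool}) (K : nat) (U : {RV P >-> nat}).

Definition eventE (e : bool) : set T := E @^-1` [set e].
Definition eventD1 : set T := D @^-1` [set true].
Definition eventU (k : nat) : set T := U @^-1` [set k].

Definition risk (e : bool) : R := cprob eventD1 (eventE e).

Definition level_risk (e : bool) (k : nat) : R :=
  cprob eventD1 (eventE e `&` eventU k).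

Definition std_risk (e : bool) : R :=
  \sum_(k < K) level_risk e k * prob (eventU k).

Definition RRobs : R := risk true / risk false.

Definition RRtrue : R := std_risk true / std_risk false.

Definition RR_EU : R :=
  max_level K (fun k => cprob (eventU k) (eventE true) /
                        cprob (eventU k) (eventE false)).

Definition RR_UD_given (e : bool) : R :=
  max_level K (level_risk e) / min_level K (level_risk e).

Definition RR_UD : R := Num.max (RR_UD_given true) (RR_UD_given false).

End relative_risks.

(* Main.v *)
(** Write [a k = P(U = k | E = 1)], [b k = P(U = k | E = 0)],
    [p e k = P(D = 1 | E = e, U = k)] and [g = RR_EU], [h = RR_UD].
    The key inequality is
    [(g + h - 1) * \sum_k p e k * a k <= g * h * \sum_k p e k * b k],
    for each [e]: the difference of the two sides is
    [h * \sum_k p e k * (g * b k - a k) - (g - 1) * \sum_k p e k * a k], and if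
    [m] is the minimum of [p e] then the first term is at least
    [h * m * (g - 1)], the second at most [(g - 1) * h * m].
    Since [P(U = k) = P(E = 1) * a k + P(E = 0) * b k], the standardized risks
    are mixtures of the sums above, and the theorem follows by combining the
    inequality for [e = 1] in the numerator of the relative risk with the one
    for [e = 0] in its denominator. *)

Require Import Defs.
From HB Require Import structures.
From mathcomp Require Import all_boot all_order all_algebra.
From mathcomp Require Import all_classical all_reals all_analysis.
From mathcomp Require Import ring lra.

Set Implicit Arguments.
Unset Strict Implicit.
Unset Printing Implicit Defensive.
Import Order.TTheory GRing.Theory Num.Theory.

Local Open Scope classical_set_scope.
Local Open Scope ring_scope.

Lemma le_max_level (R : realType) (K : nat) (f : nat -> R) (k : 'I_K) :
  f k <= max_level K f.
Proof. exact: (le_bigmax (f 0%N) (fun i : 'I_K => f i)). Qed.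

Lemma min_level_le (R : realType) (K : nat) (f : nat -> R) (k : 'I_K) :
  min_level K f <= f k.
Proof. exact: (bigmin_le (f 0%N) k (fun i : 'I_K => f i)). Qed.

Lemma min_level_ge0 (R : realType) (K : nat) (f : nat -> R) :
  (forall k, 0 <= f k) -> 0 <= min_level K f.
Proof. by move=> f_ge0; apply: le_bigmin. Qed.

Lemma prob_ge0 (d : measure_display) (T : measurableType d) (R : realType)
    (P : probability T R) (A : set T) : 0 <= prob P A.
Proof. by rewrite /prob fine_ge0. Qed.

Lemma cprob_ge0 (d : measure_display) (T : measurableType d) (R : realType)
    (P : probability T R) (A B : set T) : 0 <= cprob P A B.
Proof. by rewrite /cprob divr_ge0 ?prob_ge0. Qed.

Lemma prob_partition (d : measure_display) (T : measurableType d)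
    (R : realType) (P : probability T R) (I : finType) (F : I -> set T)
    (A : set T) :
  measurable A -> (forall i, measurable (F i)) -> trivIset setT F ->
  \bigcup_i F i = setT -> prob P A = \sum_i prob P (A `&` F i).
Proof.
move=> mA mF tF FT; rewrite /prob sum_fine; last first.
  by move=> i _; apply: fin_num_measure; apply: measurableI.
congr fine; rewrite -{1}[A]setIT -FT setI_bigcupr measure_fin_bigcup.
(* The finitely supported sum over [setT] becomes an ordinary sum along the enumeration of [I]. *)
- rewrite (@fsbig_fwiden _ _ _ _ (enum I)) ?enum_uniq ?big_enum//.
    by move=> i _; rewrite /= mem_enum.
  by move=> i [_ []].
- exact: finite_finset.
- exact: trivIset_setIl.
- by move=> i _; apply: measurableI.
Qed.

Lemma prob_sum_eventE (d : measure_display) (T : measurableType d)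
    (R : realType) (P : probability T R) (E : {RV P >-> bool}) (A : set T) :
  measurable A ->
  prob P A = prob P (A `&` eventE E true) + prob P (A `&` eventE E false).
Proof.
move=> mA; rewrite (@prob_partition _ _ _ P bool (eventE E)) ?big_bool//.
- by move=> e; apply: measurable_funPTI.
- by move=> e e' _ _ [t [<- <-]].
- by apply/seteqP; split=> // t _; exists (E t).
Qed.

Lemma prob_sum_eventU (d : measure_display) (T : measurableType d)
    (R : realType) (P : probability T R) (K : nat) (U : {RV P >-> nat})
    (A : set T) :
  (forall t, (U t < K)%N) -> measurable A ->
  prob P A = \sum_(k < K) prob P (A `&` eventU U k).
Proof.
move=> UK mA.
rewrite (@prob_partition _ _ _ P 'I_K (fun k => eventU U k))//.
- by move=> k; apply: measurable_funPTI.
- by move=> k l _ _ [t [kt lt]]; exact: val_inj (etrans (esym kt) lt).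
- by apply/seteqP; split=> // t _; exists (Ordinal (UK t)).
Qed.

Lemma weighted_mean_ratio_le (R : realFieldType) (K : nat)
    (p a b : 'I_K -> R) (g h m : R) :
  0 <= m -> 0 <= h -> 1 <= g ->
  (forall k, 0 <= a k) -> (forall k, a k <= g * b k) ->
  (forall k, m <= p k <= h * m) ->
  \sum_k a k = 1 -> \sum_k b k = 1 ->
  (g + h - 1) * (\sum_k p k * a k) <= g * h * (\sum_k p k * b k).
Proof.
move=> m0 h0 g1 a0 ab pm sa sb.
have lower : m * (g - 1) <= \sum_k p k * (g * b k - a k).
  (* Both families of weights sum to 1, so [g - 1] is the sum of the nonnegative terms
     [g * b k - a k]. *)
  rewrite -[X in g - X]sa -[g]mulr1 -{1}sb mulr_sumr -sumrB mulr_sumr.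
  apply: ler_sum => k _; rewrite mulr1 ler_wpM2r ?subr_ge0//.
  by have /andP[] := pm k.
have upper : \sum_k p k * a k <= h * m.
  rewrite -[h * m]mulr1 -sa mulr_sumr; apply: ler_sum => k _.
  by rewrite ler_wpM2r//; have /andP[] := pm k.
have diff : \sum_k p k * (g * b k - a k) =
    g * (\sum_k p k * b k) - \sum_k p k * a k.
  by rewrite mulr_sumr -sumrB; apply: eq_bigr => k _; ring.
move: lower upper; rewrite diff.
set S := \sum_k p k * a k; set T := \sum_k p k * b k => lower upper.
(* Scaling [lower] by [h] and [upper] by [g - 1] produces the same term [h * m * (g - 1)] in both,
   which cancels. *)
have := ler_wpM2l h0 lower.
have g0 : 0 <= g - 1 by rewrite subr_ge0.
have := ler_wpM2l g0 upper.
lra.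
Qed.

(** After clearing denominators the claim splits by weight: the [q1] part is [s0 <= B * t0] times
    [q1 * s1], the [q0] part is [s1 <= B * t1] times [q0 * t0]. In the application [s] and [t] are
    mean risks under the law of the confounder among the exposed and the unexposed, so [s1 / t0] is
    the observed relative risk. *)
Lemma mixture_ratio_ge (R : realFieldType) (B q1 q0 s1 t1 s0 t0 : R) :
  0 < B -> 0 <= q1 -> 0 <= q0 -> 0 <= s1 -> 0 < t0 ->
  s1 <= B * t1 -> s0 <= B * t0 -> 0 < q1 * s0 + q0 * t0 ->
  s1 / t0 / B <= (q1 * s1 + q0 * t1) / (q1 * s0 + q0 * t0).
Proof.
move=> B0 q10 q00 s10 t00 st1 st0 W0.
rewrite ler_pdivlMr// -mulrA -invfM mulrAC ler_pdivrMr ?mulr_gt0//.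
have := ler_wpM2l (mulr_ge0 q10 s10) st0.
have := ler_wpM2l (mulr_ge0 q00 (ltW t00)) st1.
lra.
Qed.

Theorem mainTheorem1 (d : measure_display) (T : measurableType d)
    (R : realType) (P : probability T R)
    (E D : {RV P >-> bool}) (K : nat) (U : {RV P >-> nat})
    (U_levels : forall t : T, (U t < K)%N)
    (EU_pos : forall (e : bool) (k : nat), (k < K)%N ->
       0 < prob P (eventE E e `&` eventU U k))
    (RRobs_den : risk E D false != 0)
    (RRtrue_den : std_risk E D K U false != 0)
    (RR_UD_den : forall e : bool, min_level K (level_risk E D U e) != 0) :
  RRtrue E D K U >=
    RRobs E D /
      ((RR_EU E K U * RR_UD E D K U) / (RR_EU E K U + RR_UD E D K U - 1)).
Proof.
(* For [K = 0] the standardized risk is an empty sum, against [RRtrue_den]. Otherwise level 0 exists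
   and serves as a witness below. *)
have [K0|K_gt0] := posnP K.
  by subst K; move: RRtrue_den; rewrite /std_risk big_ord0 eqxx.
have mE e : measurable (eventE E e) by apply: measurable_funPTI.
have mU k : measurable (eventU U k) by apply: measurable_funPTI.
have mD : measurable (eventD1 D) by apply: measurable_funPTI.
pose q e : R := prob P (eventE E e).
pose a e k : R := cprob P (eventU U k) (eventE E e).
pose p e k : R := level_risk E D U e k.
pose g := RR_EU E K U; pose h := RR_UD E D K U.
have q_gt0 e : 0 < q e.
  rewrite /q (prob_sum_eventU U_levels (mE e)).
  rewrite (bigD1 (Ordinal K_gt0))//= ltr_wpDr ?EU_pos// sumr_ge0// => k _.
  exact: prob_ge0.
have aq e k : a e k * q e = prob P (eventU U k `&` eventE E e).
  by rewrite /a /cprob divfK// gt_eqF// q_gt0.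
have a_gt0 e (k : 'I_K) : 0 < a e k.
  by rewrite -(pmulr_lgt0 _ (q_gt0 e)) aq setIC EU_pos.
have a_sum e : \sum_(k < K) a e k = 1.
  apply: (mulIf (lt0r_neq0 (q_gt0 e))); rewrite mul1r mulr_suml.
  rewrite {2}/q (prob_sum_eventU U_levels (mE e)).
  by apply: eq_bigr => k _; rewrite aq setIC.
(* Total probability over the levels of [U], within the stratum [E = e]. *)
have riskE e : risk E D e = \sum_(k < K) p e k * a e k.
  apply: (mulIf (lt0r_neq0 (q_gt0 e))).
  rewrite /risk /cprob divfK ?gt_eqF ?q_gt0// mulr_suml.
  rewrite (prob_sum_eventU U_levels (measurableI _ _ mD (mE e))).
  apply: eq_bigr => k _; rewrite -mulrA aq -setIA /p /level_risk /cprob.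
  by rewrite [eventU U k `&` _]setIC divfK// gt_eqF// EU_pos.
have std_riskE e : std_risk E D K U e =
    q true * (\sum_(k < K) p e k * a true k) +
    q false * (\sum_(k < K) p e k * a false k).
  rewrite /std_risk !mulr_sumr -big_split; apply: eq_bigr => k _ /=.
  by rewrite (prob_sum_eventE E (mU k)) -!aq -/(p e k); ring.
have p_ge0 e k : 0 <= p e k by exact: cprob_ge0.
have pm_gt0 e : 0 < min_level K (p e).
  by rewrite lt0r RR_UD_den min_level_ge0.
have le_h e : max_level K (p e) <= h * min_level K (p e).
  rewrite -ler_pdivrMr// /h /RR_UD le_max.
  by case: e; rewrite lexx ?orbT.
(* The risk at level 0 lies between the minimum and the maximum. *)
have h_ge1 : 1 <= h.
  rewrite -(ler_pM2r (pm_gt0 true)) mul1r; apply: le_trans (le_h true).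
  by apply: le_trans (min_level_le _ (Ordinal K_gt0)) (le_max_level _ _).
have le_g (k : 'I_K) : a true k <= g * a false k.
  rewrite -ler_pdivrMr//.
  exact: (le_max_level (fun k => a true k / a false k)).
(* Summing [le_g] over the levels compares two total masses equal to 1. *)
have g_ge1 : 1 <= g.
  rewrite -(a_sum true) -[g]mulr1 -(a_sum false) mulr_sumr.
  exact: ler_sum.
have key e : (g + h - 1) * (\sum_(k < K) p e k * a true k) <=
    g * h * (\sum_(k < K) p e k * a false k).
  apply: (@weighted_mean_ratio_le _ _ _ _ _ _ _ (min_level K (p e))) => //.
  - exact: ltW.
  - lra.
  - by move=> k; apply: ltW.
  - by move=> k; rewrite min_level_le (le_trans (le_max_level _ _) (le_h e)).
have den_gt0 : 0 < g + h - 1 by lra.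
have gh_gt0 : 0 < g * h by rewrite mulr_gt0//; lra.
have bound e : \sum_(k < K) p e k * a true k <=
    g * h / (g + h - 1) * (\sum_(k < K) p e k * a false k).
  by rewrite mulrAC ler_pdivlMr// mulrC key.
have pa_ge0 e e' : 0 <= \sum_(k < K) p e k * a e' k.
  by rewrite sumr_ge0// => k _; rewrite mulr_ge0// ltW.
rewrite /RRtrue /RRobs -/g -/h !std_riskE !riskE.
apply: mixture_ratio_ge => //; first by rewrite divr_gt0.
- exact: ltW.
- exact: ltW.
- by rewrite lt0r pa_ge0 -riskE RRobs_den.
- by rewrite lt0r -std_riskE RRtrue_den std_riskE addr_ge0// mulr_ge0// ltW.
Qed.
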